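(* Let $C_1,\dots,C_k$ be concept classes over sets $X_1,\dots,X_k$, and suppose each $C_i$ is learnable by an algorithm $A_i$ using only membership queries, where $A_i$ makes $\#\mathrm{Mem}_i(c_i^* )$ membership queries to learn $c_i^*\in C_i$. If a single positive example $\vec p\in\prod_{i=1}^k c_i^*$ is given, then the target $\prod_{i=1}^k c_i^*$ in the class $\{\prod_{i=1}^k c_i\mid c_i\in C_i\}$ is learnable in (at most) $k\cdot\sum_{i=1}^k\#\mathrm{Mem}_i(c_i^* )$ membership queries.
   Context: A concept class over a set $X$ is a set of subsets of $X$ (concepts). For a class $D$ over a set $Y$ with unknown target $c^*\in D$, a membership query takes $x\in Y$ and the oracle says whether $x\in c^*$. A learning algorithm for $D$ is an adaptive query strategy that, for every target $c^*\in D$, stops after finitely many queries and outputs $c^*$; complexity is measured only by the number of oracle queries. The product learner receives $\vec p$ as input before making queries. $\prod c_i=c_1\times\cdots\times c_k$ is the Cartesian product. *)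

(* Defs.v *)
From mathcomp Require Import all_boot.
From mathcomp Require Import boolp classical_sets.

Set Implicit Arguments.
Unset Strict Implicit.
Unset Printing Implicit Defensive.

Local Open Scope classical_set_scope.

(* A concept over [Y] is a [set Y]; a concept class over [Y] is a
   [set (set Y)]. *)

Inductive action (Y : Type) : Type :=
| Query of Y
| Output of set Y.

(* A deterministic adaptive strategy chooses its next action from the list
   (oldest first) of the queries made so far with their answers.  It need not
   terminate on answers that come from no target in the class. *)
Definition strategy (Y : Type) : Type := seq (Y * bool) -> action Y.

(* The query/answer history against the membership oracle of the target [c]
   after [n] steps; it is stationary once an output is produced. *)
Fixpoint transcript (Y : Type) (A : strategy Y) (c : set Y) (n : nat) :
    seq (Y * bool) :=
  if n is m.+1 then
    let h := transcript A c m in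
    if A h is Query x then rcons h (x, x \in c) else h
  else [::].

(* The size condition says that each of the [n] steps was a query (repeated
   queries are counted), so [n] is determined by [A] and [c]. *)
Definition identifies_in (Y : Type) (A : strategy Y) (c : set Y) (n : nat) :
    Prop :=
  size (transcript A c n) = n /\ A (transcript A c n) = Output c.

Definition learns (Y : Type) (A : strategy Y) (D : set (set Y))
    (mem : set Y -> nat) : Prop :=
  forall c, D c -> identifies_in A c (mem c).

Definition concept_prod (k : nat) (X : 'I_k -> Type)
    (c : forall i, set (X i)) : set (forall i, X i) :=
  [set x | forall i, c i (x i)].

Definition class_prod (k : nat) (X : 'I_k -> Type)
    (C : forall i, set (set (X i))) : set (set (forall i, X i)) :=
  [set t | exists2 c : forall i, set (X i),
             (forall i, C i (c i)) & t = concept_prod c].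

(* Main.v *)
Require Import Defs.
From mathcomp Require Import all_boot.
From mathcomp Require Import boolp classical_sets.

Local Open Scope classical_set_scope.

(** If [p] is in the product of the [c i], then replacing the coordinate [i] of
    [p] by [x] gives a point of the product exactly when [x] is in [c i].  Hence
    one query to the product oracle answers one query of [A i], and running the
    [A i] to completion costs the sum of their query counts, which is at most
    [k] times that sum (both vanish when [k = 0]). *)

Lemma mem_concept_prod_dfwith {k : nat} {X : 'I_k -> Type}
    {p : forall i, X i} {c : forall i, set (X i)} :
  concept_prod c p ->
  forall (i : 'I_k) (x : X i), (dfwith p x \in concept_prod c) = (x \in c i).
Proof.
move=> cp i x; apply/idP/idP; rewrite !inE.
  by move=> /(_ i); rewrite dfwith_in.
by move=> cx j; have [<-|ij] := eqVneq i j; [rewrite dfwith_in|rewrite dfwith_out].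
Qed.

(** Makes each factor a function of the product set and [p] alone, so that a query count can be
    defined on targets without choosing a factorisation. *)
Lemma concept_prod_section {k : nat} {X : 'I_k -> Type}
    {p : forall i, X i} {c : forall i, set (X i)} (i : 'I_k) :
  concept_prod c p -> [set x | concept_prod c (dfwith p x)] = c i.
Proof.
move=> cp; apply/seteqP; split=> x /=;
  by rewrite -[concept_prod _ _]in_setE (mem_concept_prod_dfwith cp) in_setE.
Qed.

Definition is_query {Y : Type} (a : action Y) : bool :=
  if a is Query _ then true else false.

(** The value [set0] is a mere default: [product_strategy] applies [output] only once no [A i] asks
    for a query. *)
Definition output {Y : Type} (a : action Y) : set Y :=
  if a is Output c then c else set0.

Lemma size_transcript {Y : Type} (A : strategy Y) (c : set Y) (n : nat) :
  (size (transcript A c n) <= n)%N.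
Proof.
elim: n => //= n IHn; case: (A _) => [x|_]; last exact: leqW.
by rewrite size_rcons.
Qed.

Lemma transcript_stationary {Y : Type} (A : strategy Y) (c : set Y) (m n : nat) :
  ~~ is_query (A (transcript A c m)) -> (m <= n)%N ->
  transcript A c n = transcript A c m.
Proof.
move=> Am; elim: n => [|n IHn]; first by rewrite leqn0 => /eqP->.
rewrite leq_eqVlt => /predU1P[->//|/IHn /= ->].
by case: (A _) Am.
Qed.

(** An output at a step [m < n] would freeze the transcript at length at most [m], whereas its final
    length is [n]. *)
Lemma identifies_in_query {Y : Type} {A : strategy Y} {c : set Y} {n m : nat} :
  identifies_in A c n -> (m <= n)%N ->
  is_query (A (transcript A c m)) = (m < n)%N.
Proof.
move=> [sz out]; rewrite leq_eqVlt => /predU1P[->|lt_mn].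
  by rewrite out ltnn.
rewrite lt_mn; apply: contraT => /transcript_stationary/(_ (ltnW lt_mn)) eq_mn.
by have := size_transcript A c m; rewrite -eq_mn sz leqNgt lt_mn.
Qed.

Section ProductLearner.
Context {k : nat} {X : 'I_k -> Type} (A : forall i, strategy (X i)).

(** The inner [None] is unreachable, since the picked [i] satisfies [is_query]. *)
Definition next_query (st : forall i, seq (X i * bool)) : option {i & X i} :=
  if [pick i | is_query (A i (st i))] is Some i then
    if A i (st i) is Query x then Some (Tagged X x) else None
  else None.

Definition record_answer (st : forall i, seq (X i * bool)) (b : bool) :
    forall i, seq (X i * bool) :=
  if next_query st is Some q then
    dfwith st (rcons (st (tag q)) (tagged q, b))
  else st.

(* Only the answers are replayed: a queried point does not determine the
   coordinate it was meant for, since [dfwith p (p i)] is [p] for every [i]. *)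
Definition replay (h : seq ((forall i, X i) * bool)) :
    forall i, seq (X i * bool) :=
  foldl record_answer (fun=> [::]) (unzip2 h).

Definition product_strategy (p : forall i, X i) : strategy (forall i, X i) :=
  fun h => if next_query (replay h) is Some q then
             Query (dfwith p (tagged q))
           else Output (concept_prod (fun i => output (A i (replay h i)))).

Lemma next_queryP (st : forall i, seq (X i * bool)) :
  if next_query st is Some q then A (tag q) (st (tag q)) = Query (tagged q)
  else forall i, ~~ is_query (A i (st i)).
Proof.
rewrite /next_query; case: pickP => [i|noq i]; last by rewrite noq.
by case E: (A i (st i)) => [x|//] _.
Qed.

Lemma replay_rcons h y b :
  replay (rcons h (y, b)) = record_answer (replay h) b.
Proof. by rewrite /replay /unzip2 map_rcons foldl_rcons. Qed.

Context {p : forall i, X i} {c : forall i, set (X i)} {M : 'I_k -> nat}.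
Hypotheses (cp : concept_prod c p)
  (Ac : forall i, identifies_in (A i) (c i) (M i)).

(** Invariant of the interleaving: the replayed state of each [A i] is a genuine partial run against
    [c i], and each product query advances exactly one of these runs by one step. *)
Lemma product_transcript (m : nat) : (m <= \sum_(i < k) M i)%N ->
  let h := transcript (product_strategy p) (concept_prod c) m in
  size h = m /\
  exists n : 'I_k -> nat,
    [/\ forall i, (n i <= M i)%N, (\sum_(i < k) n i)%N = m
      & forall i, replay h i = transcript (A i) (c i) (n i)].
Proof.
elim: m => [_|m IHm lt_m].
  by split=> //; exists (fun=> 0); split=> //; rewrite big1.
have [/= sz [n [le_nM sum_n st_n]]] := IHm (ltnW lt_m).
set h := transcript _ _ m in sz st_n *.
rewrite /product_strategy.
have := next_queryP (replay h).
case E: (next_query _) => [[i x]|] /= Aq; last first.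
  (* If no [A i] wants to query, every run has reached its full length, so [m] is already the whole
     sum, contradicting [lt_m]. *)
  have le_Mn i : (M i <= n i)%N.
    by rewrite leqNgt -(identifies_in_query (Ac i) (le_nM i)) -st_n.
  by move: lt_m; rewrite -sum_n ltnNge leq_sum.
rewrite size_rcons sz; split=> //.
(* Only the run that asked the query advances; it stays within [M i] because a run that still
   queries is strictly shorter than [M i]. *)
exists (fun j => n j + (i == j)); split=> [j||j].
- have [<-|_] := eqVneq i j; last by rewrite addn0.
  by rewrite addn1 -(identifies_in_query (Ac i) (le_nM i)) -st_n Aq.
- rewrite big_split /= sum_n (bigD1 i) //= eqxx big1 ?addn0 ?addn1 // => j.
  by rewrite eq_sym => /negPf->.
rewrite replay_rcons (mem_concept_prod_dfwith cp) /record_answer E /=.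
have [<-|ij] := eqVneq i j.
  by rewrite dfwith_in addn1 /= -st_n Aq.
by rewrite dfwith_out // addn0.
Qed.

Lemma product_strategy_identifies :
  identifies_in (product_strategy p) (concept_prod c) (\sum_(i < k) M i).
Proof.
have [sz [n [le_nM sum_n st_n]]] := product_transcript _ (leqnn _).
split=> //; rewrite /product_strategy.
(* Termwise bounds [n i <= M i] with equal sums force equality in every term. *)
have nM i : n i = M i.
  have [_ /esym] := leqif_sum (fun i (_ : true) => leqif_eq (le_nM i)).
  by rewrite sum_n eqxx => /forallP/(_ i)/eqP.
have out i := st_n i; move: out; set st := replay _ => out.
have {}out i : A i (st i) = Output (c i).
  by rewrite out nM; have [] := Ac i.
have := next_queryP st.
case: next_query => [q|_]; first by rewrite out.
by congr (Output (concept_prod _)); apply: functional_extensionality_dep => i;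
  rewrite out.
Qed.

End ProductLearner.

Theorem proposition5 (k : nat) (X : 'I_k -> Type)
    (C : forall i : 'I_k, set (set (X i)))
    (A : forall i : 'I_k, strategy (X i))
    (Mem : forall i : 'I_k, set (X i) -> nat)
    (hA : forall i : 'I_k, learns (A i) (C i) (Mem i)) :
  exists (B : (forall i : 'I_k, X i) -> strategy (forall i : 'I_k, X i))
         (MemB : (forall i : 'I_k, X i) -> set (forall i : 'I_k, X i) -> nat),
    (forall p : forall i : 'I_k, X i,
        learns (B p) [set t | class_prod C t /\ t p] (MemB p)) /\
    (forall (p : forall i : 'I_k, X i) (c : forall i : 'I_k, set (X i)),
        (forall i : 'I_k, C i (c i)) -> concept_prod c p ->
        (MemB p (concept_prod c) <= k * \sum_(i < k) Mem i (c i))%N).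
Proof.
exists (product_strategy A).
(* The count sees only [p] and the target [t], so the factor [i] is read off as the section of [t]
   through [p]. *)
exists (fun p t => \sum_(i < k) Mem i [set x | t (dfwith p x)]).
have MemE p (c : forall i, set (X i)) : concept_prod c p ->
    \sum_(i < k) Mem i [set x | concept_prod c (dfwith p x)] =
    \sum_(i < k) Mem i (c i).
  by move=> cp; apply: eq_bigr => i _; rewrite concept_prod_section.
split=> [p t [[c Cc ->] cp]|p c Cc cp]; rewrite MemE //.
  by apply: product_strategy_identifies => // i; apply: hA.
have [k0|k_gt0] := posnP k; last exact: leq_pmull.
by subst k; rewrite big_ord0.
Qed.
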